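(* Let $G=(V,E)$ be a finite graph and let $Q\in\mathbb{R}^V$ be such that $H_Q=\Delta_G+Q$ does not satisfy Condition (S). Then $H_Q$ fails to do phase retrieval: for $T>0$, there exist $u_0,v_0\in\mathbb{C}^V$ with $|(e^{-itH_Q}u_0)(j)|=|(e^{-itH_Q}v_0)(j)|$ for all $t\in[0,T]$ and $j\in V$, but such that there is no $c\in\mathbb{C}$ with $|c|=1$ and $v_0=c\,u_0$.
   Context: $G=(V,E)$ is a finite simple undirected graph with $|V|=n$. Its combinatorial Laplacian is $\Delta_G u(j)=\sum_{k\sim j}(u(j)-u(k))$. A potential $Q\in\mathbb{R}^V$ is identified with the diagonal operator $(Qu)(j)=Q(j)u(j)$. Let $(\phi_k)_{k=1}^n$ be a real orthonormal basis of eigenvectors of $H_Q$. Condition (S): for every pair $k\neq\ell$ there is $j\in V$ with $\phi_k(j)\phi_\ell(j)\neq0$. Thus the failure of (S) means that there are $k\neq\ell$ such that $\phi_k$ and $\phi_\ell$ have disjoint supports. *)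

(* Defs.v *)
From HB Require Import structures.
From mathcomp Require Import all_boot all_order all_algebra complex.
From mathcomp Require Import all_classical all_reals all_analysis.

Set Implicit Arguments.
Unset Strict Implicit.
Unset Printing Implicit Defensive.

Import Order.TTheory GRing.Theory Num.Theory numFieldNormedType.Exports.

Local Open Scope classical_set_scope.
Local Open Scope ring_scope.
Local Open Scope complex_scope.

(* A finite simple graph is a finType of vertices with a symmetric irreflexive
   adjacency relation.  K^V is {ffun V -> K^o}: the regular module K^o provides
   the K-linear structure and, for K = R[i], the usual topology of C. *)

Definition laplacian (K : nzRingType) (V : finType) (adj : rel V)
    (u : {ffun V -> K^o}) : {ffun V -> K^o} :=
  [ffun j => \sum_(k | adj j k) (u j - u k)].

Definition schrodinger (K : nzRingType) (V : finType) (adj : rel V)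
    (Q : V -> K) (u : {ffun V -> K^o}) : {ffun V -> K^o} :=
  [ffun j => laplacian adj u j + Q j * u j].

(* H_Q acting on C^V, for a real potential Q. *)
Definition schrodingerC (R : realType) (V : finType) (adj : rel V)
    (Q : V -> R) : {ffun V -> R[i]^o} -> {ffun V -> R[i]^o} :=
  schrodinger adj (fun j => (Q j)%:C).

(* (exp A) u = \sum_m A^m u / m!, the series being summed vertexwise. *)
Definition expop (R : realType) (V : finType)
    (A : {ffun V -> R[i]^o} -> {ffun V -> R[i]^o})
    (u : {ffun V -> R[i]^o}) : {ffun V -> R[i]^o} :=
  [ffun j => lim (series
     ((fun m => (m`!%:R)^-1 * iter m A u j) : (R[i]^o)^nat) @ \oo)].

(* e^{-itH_Q} u *)
Definition evolution (R : realType) (V : finType) (adj : rel V) (Q : V -> R)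
    (t : R) (u : {ffun V -> R[i]^o}) : {ffun V -> R[i]^o} :=
  expop (fun w => (- ('i * t%:C)) *: schrodingerC adj Q w) u.

Definition orthonormal_eigenbasis (R : realType) (V : finType) (adj : rel V)
    (Q : V -> R) (phi : #|V|.-tuple {ffun V -> R^o}) : Prop :=
  [/\ basis_of fullv phi,
      (forall k l, \sum_(j : V) tnth phi k j * tnth phi l j = (k == l)%:R)
    & (forall k, exists lambda : R,
         schrodinger adj Q (tnth phi k) = lambda *: tnth phi k)].

Definition conditionS (R : realType) (V : finType)
    (phi : #|V|.-tuple {ffun V -> R^o}) : Prop :=
  forall k l, k != l -> exists j : V, tnth phi k j * tnth phi l j != 0.

(* Main.v *)
(* Take [phi_k], [phi_l] with disjoint supports, [u0 = phi_k + phi_l] and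
   [v0 = phi_k - phi_l].  At a vertex [j] only one of the two modes is nonzero,
   so every power of the generator gives [u0] and [v0] the same value at [j] up
   to a sign depending on [j] alone, and so does the exponential.  If [v0] were
   [c u0], the support of [phi_k] would give [c = 1], that of [phi_l] [c = -1]. *)
Require Import Defs.
From HB Require Import structures.
From mathcomp Require Import all_boot all_order all_algebra complex.
From mathcomp Require Import all_classical all_reals all_analysis.
From mathcomp Require Import ring.
Import Order.TTheory GRing.Theory Num.Theory numFieldNormedType.Exports.
Local Open Scope ring_scope.
Local Open Scope complex_scope.

Section Schrodinger.
Variables (K : comNzRingType) (V : finType) (adj : rel V) (Q : V -> K).

Lemma schrodingerD (u v : {ffun V -> K^o}) :
  schrodinger adj Q (u + v) = schrodinger adj Q u + schrodinger adj Q v.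
Proof.
apply/ffunP => j; rewrite !ffunE mulrDr addrACA; congr (_ + _).
by rewrite -big_split /=; apply: eq_bigr => k _; rewrite !ffunE opprD addrACA.
Qed.

Lemma schrodingerZ (a : K) (u : {ffun V -> K^o}) :
  schrodinger adj Q (a *: u) = a *: schrodinger adj Q u.
Proof.
apply/ffunP => j; rewrite !ffunE scalerDr; congr (_ + _).
  rewrite scaler_sumr; apply: eq_bigr => k _.
  by rewrite !ffunE scalerBr.
by rewrite /GRing.scale /= mulrCA.
Qed.

Variables (z a b : K) (f g : {ffun V -> K^o}).
Hypotheses (Hf : schrodinger adj Q f = a *: f).
Hypotheses (Hg : schrodinger adj Q g = b *: g).

(** On the span of two eigenvectors the generator is diagonal, so its powers have a closed form. The
    scalar [s] lets one formula serve both the sum ([s = 1]) and the difference ([s = -1]). *)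
Lemma iter_schrodinger_eigenD s m :
  iter m (fun w => z *: schrodinger adj Q w) (f + s *: g) =
  (z * a) ^+ m *: f + (s * (z * b) ^+ m) *: g.
Proof.
elim: m => [|m IH]; first by rewrite !expr0 mulr1 scale1r.
rewrite iterS IH schrodingerD !schrodingerZ Hf Hg scalerDr !scalerA.
by congr (_ *: _ + _ *: _); rewrite exprS; ring.
Qed.

Lemma iter_schrodinger_eigenB_opp m j : f j = 0 ->
  iter m (fun w => z *: schrodinger adj Q w) (f - g) j =
  - iter m (fun w => z *: schrodinger adj Q w) (f + g) j.
Proof.
move=> fj0; rewrite -scaleN1r -[g in RHS]scale1r !iter_schrodinger_eigenD.
by rewrite !ffunE fj0 !scaler0 !add0r mul1r mulN1r scaleNr.
Qed.

Lemma iter_schrodinger_eigenB m j : g j = 0 ->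
  iter m (fun w => z *: schrodinger adj Q w) (f - g) j =
  iter m (fun w => z *: schrodinger adj Q w) (f + g) j.
Proof.
move=> gj0; rewrite -scaleN1r -[g in RHS]scale1r !iter_schrodinger_eigenD.
by rewrite !ffunE gj0 !scaler0.
Qed.

End Schrodinger.

Section Complexification.
Variables (R : realType) (V : finType).

Definition complexify (f : {ffun V -> R^o}) : {ffun V -> R[i]^o} :=
  [ffun j => (f j)%:C].

(** The embedding of the reals into [R[i]] is a ring morphism, and the potential is real, so it
    commutes with the operator; real eigenvectors thus become initial data for the complex
    evolution. *)
Lemma schrodingerC_complexify (adj : rel V) (Q : V -> R) (a : R)
    (f : {ffun V -> R^o}) :
  schrodinger adj Q f = a *: f ->
  schrodingerC adj Q (complexify f) = a%:C *: complexify f.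
Proof.
move=> /ffunP Hf; apply/ffunP => j; move: (Hf j); rewrite !ffunE => Hj.
(* Folding the right side into the image of one real number exposes the real eigenvalue equation at
   [j]. *)
rewrite [RHS](_ : _ = (a *: f j)%:C); last by rewrite rmorphM.
rewrite -Hj rmorphD rmorphM rmorph_sum; congr (_ + _).
by apply: eq_bigr => k _; rewrite !ffunE rmorphB.
Qed.

End Complexification.

Arguments complexify {R V} f.

(* No convergence is assumed: [s] and [- s] diverge together, and then both
   limits are the same default point. *)
Lemma norm_limN (K : numFieldType) (W : normedModType K) (s : nat -> W) :
  `|limn (fun n => - s n)| = `|limn s|.
Proof.
have [cs|ds] := pselect (cvgn s); first by rewrite limN // normrN.
rewrite (dvgP ds) dvgP // => cNs; apply: ds.
by rewrite -is_cvgNE.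
Qed.

Section SignedExponential.
Variables (R : realType) (V : finType).
Variable A : {ffun V -> R[i]^o} -> {ffun V -> R[i]^o}.

(** The sign factors out of every partial sum of the exponential series at [j], and the modulus of
    the limit does not see it. *)
Lemma norm_expop_opp (u v : {ffun V -> R[i]^o}) (j : V) :
  (forall m, iter m A v j = - iter m A u j) ->
  `|expop A v j| = `|expop A u j|.
Proof.
move=> H; rewrite !ffunE.
set s := series (fun m => _ * iter m A u j).
rewrite (_ : series _ = fun n => - s n); first exact: norm_limN.
apply/funext => n; rewrite /s /series /= -sumrN; apply: eq_bigr => m _.
by rewrite H mulrN.
Qed.

Lemma eq_expop (u v : {ffun V -> R[i]^o}) (j : V) :
  (forall m, iter m A v j = iter m A u j) -> expop A v j = expop A u j.
Proof.
move=> H; rewrite !ffunE; congr (limn _).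
apply/funext => n; rewrite /series /=; apply: eq_bigr => m _.
by rewrite H.
Qed.

End SignedExponential.

Lemma norm_evolution_disjoint (R : realType) (V : finType) (adj : rel V)
    (Q : V -> R) (f g : {ffun V -> R^o}) (a b t : R) (j : V) :
  schrodinger adj Q f = a *: f -> schrodinger adj Q g = b *: g ->
  f j * g j = 0 ->
  `|evolution adj Q t (complexify f + complexify g) j| =
  `|evolution adj Q t (complexify f - complexify g) j|.
Proof.
move=> /(schrodingerC_complexify _ _ _ _ _ _) Hf.
move=> /(schrodingerC_complexify _ _ _ _ _ _) Hg /eqP.
(* Where [f] vanishes the two evolutions are opposite at [j]; where [g] vanishes they are equal. *)
rewrite mulf_eq0 => /orP[] /eqP j0; apply/esym.
  apply: norm_expop_opp => m.
  apply: (iter_schrodinger_eigenB_opp _ _ _ _ _ _ _ _ _ Hf Hg).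
  by rewrite ffunE j0.
congr (`|_|); apply: eq_expop => m.
apply: (iter_schrodinger_eigenB _ _ _ _ _ _ _ _ _ Hf Hg).
by rewrite ffunE j0.
Qed.

Lemma orthonormal_neq0 (R : realType) (V : finType)
    (phi : #|V|.-tuple {ffun V -> R^o}) :
  (forall k l, \sum_(j : V) tnth phi k j * tnth phi l j = (k == l)%:R) ->
  forall k, exists j, tnth phi k j != 0.
Proof.
move=> on k; apply: contrapT => /forallNP H0.
have := on k k; rewrite eqxx big1 => [/eqP|j _].
  by rewrite eq_sym oner_eq0.
by have /negP := H0 j; rewrite negbK => /eqP ->; rewrite mul0r.
Qed.

Theorem lemma4p1 (R : realType) (V : finType) (adj : rel V)
  (adj_sym : symmetric adj) (adj_irr : irreflexive adj)
  (Q : V -> R) (phi : #|V|.-tuple {ffun V -> R^o})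
  (phi_eigenbasis : orthonormal_eigenbasis adj Q phi)
  (notS : ~ conditionS phi) (T : R) (T_gt0 : 0 < T) :
  exists u0 v0 : {ffun V -> R[i]^o},
    (forall (t : R) (j : V), 0 <= t <= T ->
       `|evolution adj Q t u0 j| = `|evolution adj Q t v0 j|) /\
    ~ (exists c : R[i], `|c| = 1 /\ v0 = c *: u0).
Proof.
have [_ /orthonormal_neq0 phi_neq0 eig] := phi_eigenbasis.
(* Such [k] and [l] are automatically distinct, since each mode is nonzero somewhere. *)
have [k [l disj]] : exists k l, forall j, tnth phi k j * tnth phi l j = 0.
  apply: contrapT => H; apply: notS => k l _; apply: contrapT => /forallNP Hj.
  apply: H; exists k, l => j; apply/eqP.
  by rewrite -[_ == _]negbK; apply/negP/Hj.
have [[a Ha] [b Hb]] := (eig k, eig l).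
exists (complexify (tnth phi k) + complexify (tnth phi l)).
exists (complexify (tnth phi k) - complexify (tnth phi l)).
split=> [t j _|[c [_ /ffunP Hc]]].
  exact: norm_evolution_disjoint Ha Hb (disj j).
have [[j pj] [j' pj']] := (phi_neq0 k, phi_neq0 l).
have lj0 : tnth phi l j = 0.
  by apply/eqP; move/eqP: (disj j); rewrite mulf_eq0 (negPf pj).
have kj0 : tnth phi k j' = 0.
  by apply/eqP; move/eqP: (disj j'); rewrite mulf_eq0 (negPf pj') orbF.
(* At [j] only the [k]-th mode survives, with the same sign in both vectors, and it can be
   cancelled. *)
have c1 : c = 1.
  have pjC : (tnth phi k j)%:C != 0 :> R[i] by rewrite fmorph_eq0.
  apply: (mulIf pjC); rewrite mul1r.
  by have := Hc j; rewrite !ffunE lj0 subr0 addr0.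
(* At [j'] the relation says that the [l]-th mode equals its opposite, so twice a nonzero number
   would vanish. *)
have := Hc j'; rewrite !ffunE kj0 c1 scale1r add0r add0r => /eqP.
by rewrite eq_sym -addr_eq0 -mulr2n mulrn_eq0 /= fmorph_eq0 (negPf pj').
Qed.
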